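(* Let $\bar k_\pm\in\mathbb C(q)$, let $\bar\epsilon_\pm$ satisfy $[\bar\epsilon_\pm,U_q(\widehat{gl_2})]=0$, and set $$\tilde K^0(z)=\begin{pmatrix}\bar\epsilon_+&\frac{\bar k_+(q+q^{-1})}{q-q^{-1}}\\ \frac{\bar k_-(q+q^{-1})}{q-q^{-1}}&\frac{\bar\epsilon_-}{z}\end{pmatrix},\qquad L^{-,0}=\mathrm{diag}\big((\mathsf k^-_{2,0})^{-1},(\mathsf k^-_{1,0})^{-1}\big).$$ Then for any invertible $\lambda$ such that $[\lambda,U_q(\widehat{gl_2})]=0$, the K-operator $$\tilde K(z)=\tilde K^-(z)=L^-(z\lambda)\,\tilde K^0(z)\,L^{-,0}$$ satisfies $$\tilde R_{12}(z/w)\,(\tilde K(z)\otimes\mathbb I)\,R^{(0)}\,(\mathbb I\otimes\tilde K(w))=(\mathbb I\otimes\tilde K(w))\,R^{(0)}\,(\tilde K(z)\otimes\mathbb I)\,\tilde R_{21}(z/w).$$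
   Context: Base field $\mathbb C(q)$, $q$ an indeterminate; $\mathbb N=\{0,1,2,\dots\}$; $\mathbb I$ is the $2\times2$ identity. On $\mathbb C^2\otimes\mathbb C^2$ let $$\tilde R(z)=\tilde R_{12}(z)=\begin{pmatrix}1&0&0&0\\0&\frac{z-1}{zq-q^{-1}}&\frac{z(q-q^{-1})}{zq-q^{-1}}&0\\0&\frac{q-q^{-1}}{zq-q^{-1}}&\frac{z-1}{zq-q^{-1}}&0\\0&0&0&1\end{pmatrix},\qquad R^{(0)}=\mathrm{diag}(1,q^{-1},q^{-1},1),$$ $P=\tilde R(1)$ the permutation operator, and $\tilde R_{21}(z)=P\tilde R_{12}(z)P$. $U_q(\widehat{gl_2})$ is the unital associative algebra with generators $\mathsf x^\pm_k$ ($k\in\mathbb Z$), $\mathsf k^+_{j,-\ell},\mathsf k^-_{j,\ell}$ ($\ell\in\mathbb N$, $j=1,2$), and central, mutually inverse elements $q^{\pm c/2}$, with the following relations (FRT presentation). Put $$L^\pm(z)=\begin{pmatrix}\mathsf k_1^\pm(z)&\mathsf k_1^\pm(z)\mathsf f^\pm(z)\\ \mathsf e^\pm(z)\mathsf k_1^\pm(z)&\mathsf k_2^\pm(z)+\mathsf e^\pm(z)\mathsf k_1^\pm(z)\mathsf f^\pm(z)\end{pmatrix},$$ $\mathsf e^+(z)=(q-q^{-1})\sum_{k\ge0}q^{k(c/2-1)}\mathsf x^-_{-k}z^k$, $\mathsf e^-(z)=-(q-q^{-1})\sum_{k\ge1}q^{k(c/2+1)}\mathsf x^-_kz^{-k}$,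 $\mathsf f^+(z)=(q-q^{-1})\sum_{k\ge1}q^{-k(c/2+1)}\mathsf x^+_{-k}z^k$, $\mathsf f^-(z)=-(q-q^{-1})\sum_{k\ge0}q^{-k(c/2-1)}\mathsf x^+_kz^{-k}$, $\mathsf k^+_j(z)=\sum_{k\ge0}\mathsf k^+_{j,-k}z^k$, $\mathsf k^-_j(z)=\sum_{k\ge0}\mathsf k^-_{j,k}z^{-k}$. The relations are $\mathsf k^+_{i,0}\mathsf k^-_{i,0}=\mathsf k^-_{i,0}\mathsf k^+_{i,0}=1$, $$\tilde R(z/w)(L^\pm(z)\otimes\mathbb I)(\mathbb I\otimes L^\pm(w))=(\mathbb I\otimes L^\pm(w))(L^\pm(z)\otimes\mathbb I)\tilde R(z/w),$$ $$\tilde R(q^cz/w)(L^+(z)\otimes\mathbb I)(\mathbb I\otimes L^-(w))=(\mathbb I\otimes L^-(w))(L^+(z)\otimes\mathbb I)\tilde R(q^{-c}z/w),$$ where in the first family $\tilde R(z/w)$ may be expanded in $z/w$ or $w/z$ and in the last relation the expansion is in $z/w$. *)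

(* Defs.v *)
From HB Require Import structures.
From mathcomp Require Import all_boot all_algebra.
From mathcomp Require Import reals complex mxtens.

Set Implicit Arguments.
Unset Strict Implicit.
Unset Printing Implicit Defensive.

Import GRing.Theory.
Local Open Scope ring_scope.

(** The base field C(q) and its indeterminate. *)
Definition Cq (R : realType) : fieldType := {fraction {poly R[i]}}.
Definition qvar (R : realType) : Cq R := tofrac 'X.

Definition mx_of_rows (T : pzRingType) (m n : nat) (s : seq (seq T)) : 'M[T]_(m, n) :=
  \matrix_(i, j) nth 0 (nth [::] s i) j.

Section RMatrix.
Variables (K : fieldType) (q : K).

(** Matrices on C^2 (x) C^2 are indexed by 'I_(2 * 2), in the order of [*t]
    ([mxtens]): 11, 12, 21, 22. *)
Definition Rt (z : K) : 'M[K]_(2 * 2) := mx_of_rows (2 * 2) (2 * 2)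
  [:: [:: 1; 0; 0; 0];
      [:: 0; (z - 1) / (z * q - q^-1); z * (q - q^-1) / (z * q - q^-1); 0];
      [:: 0; (q - q^-1) / (z * q - q^-1); (z - 1) / (z * q - q^-1); 0];
      [:: 0; 0; 0; 1]].

Definition R0 : 'M[K]_(2 * 2) := mx_of_rows (2 * 2) (2 * 2)
  [:: [:: 1; 0; 0; 0]; [:: 0; q^-1; 0; 0]; [:: 0; 0; q^-1; 0]; [:: 0; 0; 0; 1]].

Definition Pmx : 'M[K]_(2 * 2) := Rt 1.

(** (z q - q^-1) Rt(z) = Rnum0 + z Rnum1, see [Rt_num]. *)
Definition Rnum0 : 'M[K]_(2 * 2) := mx_of_rows (2 * 2) (2 * 2)
  [:: [:: - q^-1; 0; 0; 0]; [:: 0; -1; 0; 0];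
      [:: 0; q - q^-1; -1; 0]; [:: 0; 0; 0; - q^-1]].
Definition Rnum1 : 'M[K]_(2 * 2) := mx_of_rows (2 * 2) (2 * 2)
  [:: [:: q; 0; 0; 0]; [:: 0; 1; q - q^-1; 0];
      [:: 0; 0; 1; 0]; [:: 0; 0; 0; q]].

(** Rational functions of z/w are expanded either in powers of z/w or in powers
    of w/z. *)
Variant expansion := In_z_over_w | In_w_over_z.

(** Coefficient of (z/w)^i, resp. (w/z)^i, in the expansion of Rt(z/w), obtained
    from the geometric series of 1/(x q - q^-1) at x = 0, resp. x = oo.  The
    lemmas [Rser_zw0] to [Rser_wzS] check that multiplying by x q - q^-1 gives
    back Rnum0 + x Rnum1. *)
Definition Rser (d : expansion) (i : nat) : 'M[K]_(2 * 2) :=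
  match d with
  | In_z_over_w =>
      - q *: (q ^+ (2 * i) *: Rnum0
              + (if (0 < i)%N then q ^+ (2 * i.-1) *: Rnum1 else 0))
  | In_w_over_z =>
      q^-1 *: (q ^- (2 * i) *: Rnum1
               + (if (0 < i)%N then q ^- (2 * i.-1) *: Rnum0 else 0))
  end.

Definition Rser21 (d : expansion) (i : nat) : 'M[K]_(2 * 2) :=
  Pmx *m Rser d i *m Pmx.

Lemma Rt_num (z : K) : z * q - q^-1 != 0 ->
  (z * q - q^-1) *: Rt z = Rnum0 + z *: Rnum1.
Proof.
move=> nz; apply/matrixP=> -[[|[|[|[|i]]]] hi] -[[|[|[|[|j]]]] hj] //=;
  rewrite !mxE /= ?mulr0 ?addr0 ?mulr1 ?add0r //; first [by rewrite addrC | idtac].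
- by rewrite mulrCA divff // mulr1 addrC.
- by rewrite mulrCA divff // mulr1.
- by rewrite mulrCA divff // mulr1.
- by rewrite mulrCA divff // mulr1 addrC.
Qed.

Lemma Rser_zw0 : q != 0 -> - q^-1 *: Rser In_z_over_w 0 = Rnum0.
Proof. by move=> nz; rewrite /Rser /= addr0 !scalerA mulrNN mulVf // mulr1 scale1r. Qed.

Lemma Rser_zwS (i : nat) : q != 0 ->
  q *: Rser In_z_over_w i - q^-1 *: Rser In_z_over_w i.+1
  = if i == 0%N then Rnum1 else 0.
Proof.
move=> nz; rewrite /Rser /= [q^-1 *: _]scalerA mulrN mulVf // scaleN1r opprK.
rewrite [q *: _]scalerA mulrN -expr2.
case: i => [|i] /=.
  by rewrite muln0 muln1 !expr0 !addr0 !scale1r addrA scaleNr addNr add0r.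
have e n : q ^+ (2 * n.+1) = q ^+ 2 * q ^+ (2 * n) by rewrite mulnS exprD.
by rewrite scaleNr scalerDr !scalerA -!e addNr.
Qed.

Lemma Rser_wz0 : q != 0 -> q *: Rser In_w_over_z 0 = Rnum1.
Proof.
by move=> nz; rewrite /Rser /= addr0 muln0 expr0 invr1 scale1r scalerA divff ?scale1r.
Qed.

Lemma Rser_wzS (i : nat) : q != 0 ->
  q *: Rser In_w_over_z i.+1 - q^-1 *: Rser In_w_over_z i
  = if i == 0%N then Rnum0 else 0.
Proof.
move=> nz; rewrite /Rser /= [q *: _]scalerA divff // scale1r.
rewrite [q^-1 *: _]scalerA -invfM -expr2.
case: i => [|i] /=.
  by rewrite muln0 muln1 !expr0 !addr0 !invr1 !scale1r addrAC subrr add0r.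
have e n : q ^- (2 * n.+1) = q ^- 2 * q ^- (2 * n) by rewrite mulnS exprD invfM.
by rewrite [X in _ - X]scalerDr !scalerA -!e subrr.
Qed.

End RMatrix.

Section FormalSeries.
Variable A : pzRingType.

(** sum_n f_n z^n and sum_n f_n z^-n as families of coefficients indexed by the
    integer exponent of z. *)
Definition in_z (V : nmodType) (f : nat -> V) (a : int) : V :=
  if a is Posz n then f n else 0.
Definition in_zinv (V : nmodType) (f : nat -> V) (a : int) : V := in_z f (- a).

Definition cauchy (f g : nat -> A) (n : nat) : A :=
  \sum_(i < n.+1) f i * g (n - i)%N.

(** The coefficient of z^a w^b is [X a b]. *)
Definition series2 := int -> int -> 'M[A]_(2 * 2).

Definition exp_shift (d : expansion) (i : nat) : int :=
  match d with In_z_over_w => i%:Z | In_w_over_z => - i%:Z end.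

(** Products R(z/w) X(z,w) and X(z,w) R(z/w), for R(z/w) expanded as
    sum_i r_i (z/w)^i, resp. sum_i r_i (w/z)^i.  The coefficient of z^a w^b is
    the sum over all i of r_i X_{a-i,b+i}, resp. r_i X_{a+i,b-i}; the terms with
    i > |a| + |b| vanish, for either expansion, when X is a series in (z, w) or
    in (1/z, 1/w), and, for the expansion in z/w, when X is a series in
    (z, 1/w).  These are the only uses below. *)
Definition mulRX (d : expansion) (r : nat -> 'M[A]_(2 * 2)) (X : series2) : series2 :=
  fun a b => \sum_(i < (`|a| + `|b|).+1)
    r i *m X (a - exp_shift d i) (b + exp_shift d i).
Definition mulXR (d : expansion) (X : series2) (r : nat -> 'M[A]_(2 * 2)) : series2 :=
  fun a b => \sum_(i < (`|a| + `|b|).+1)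
    X (a - exp_shift d i) (b + exp_shift d i) *m r i.

(** (X(z) (x) 1) M (1 (x) Y(w)) and (1 (x) Y(w)) M (X(z) (x) 1). *)
Definition tens12 (X : int -> 'M[A]_2) (M : 'M[A]_(2 * 2)) (Y : int -> 'M[A]_2) : series2 :=
  fun a b => (X a *t (1%:M : 'M_2)) *m M *m ((1%:M : 'M_2) *t Y b).
Definition tens21 (X : int -> 'M[A]_2) (M : 'M[A]_(2 * 2)) (Y : int -> 'M[A]_2) : series2 :=
  fun a b => ((1%:M : 'M_2) *t Y b) *m M *m (X a *t (1%:M : 'M_2)).

End FormalSeries.

(** Generators; the index j = 1, 2 of k_j is represented by 0, 1 : 'I_2.
    [Xp k], [Xm k] stand for x^+_k, x^-_k; [Kp j l] for k^+_{j,-l}; [Km j l] for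
    k^-_{j,l}; [Qc], [Qcinv] for q^{c/2}, q^{-c/2}. *)
Inductive Uq_gen : Type :=
  | Xp of int
  | Xm of int
  | Kp of 'I_2 & nat
  | Km of 'I_2 & nat
  | Qc
  | Qcinv.

Section Uq.
Variables (K : fieldType) (q : K).

Section LOperators.
Variables (A : algType K) (g : Uq_gen -> A).

(** e^+, f^+, k_j^+ are series in z, and e^-, f^-, k_j^- series in 1/z; the
    argument is the absolute value of the exponent of z. *)
Definition e_plus (k : nat) : A :=
  ((q - q^-1) * q ^- k) *: (g Qc ^+ k * g (Xm (- k%:Z))).
Definition e_minus (k : nat) : A :=
  if k == 0%N then 0 else (- (q - q^-1) * q ^+ k) *: (g Qc ^+ k * g (Xm k%:Z)).
Definition f_plus (k : nat) : A :=
  if k == 0%N then 0 else ((q - q^-1) * q ^- k) *: (g Qcinv ^+ k * g (Xp (- k%:Z))).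
Definition f_minus (k : nat) : A :=
  (- (q - q^-1) * q ^+ k) *: (g Qcinv ^+ k * g (Xp k%:Z)).

Definition Lmx (k1 k2 e f : nat -> A) (n : nat) : 'M[A]_2 := mx_of_rows 2 2
  [:: [:: k1 n; cauchy k1 f n];
      [:: cauchy e k1 n; k2 n + cauchy (cauchy e k1) f n]].

Definition L_plus : nat -> 'M[A]_2 := Lmx (g \o Kp 0) (g \o Kp 1) e_plus f_plus.
Definition L_minus : nat -> 'M[A]_2 := Lmx (g \o Km 0) (g \o Km 1) e_minus f_minus.

Definition to_A (M : 'M[K]_(2 * 2)) : 'M[A]_(2 * 2) := map_mx (in_alg A) M.

Record Uq_relations : Prop := {
  Uq_Qc_mul : g Qc * g Qcinv = 1 /\ g Qcinv * g Qc = 1;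
  Uq_Qc_central : forall x, GRing.comm (g Qc) (g x) /\ GRing.comm (g Qcinv) (g x);
  Uq_K_mul : forall j, g (Kp j 0) * g (Km j 0) = 1 /\ g (Km j 0) * g (Kp j 0) = 1;
  Uq_RLL_plus : forall (d : expansion) (a b : int),
    mulRX d (fun i => to_A (Rser q d i)) (tens12 (in_z L_plus) 1%:M (in_z L_plus)) a b =
    mulXR d (tens21 (in_z L_plus) 1%:M (in_z L_plus)) (fun i => to_A (Rser q d i)) a b;
  Uq_RLL_minus : forall (d : expansion) (a b : int),
    mulRX d (fun i => to_A (Rser q d i)) (tens12 (in_zinv L_minus) 1%:M (in_zinv L_minus)) a b =
    mulXR d (tens21 (in_zinv L_minus) 1%:M (in_zinv L_minus)) (fun i => to_A (Rser q d i)) a b;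
  Uq_RLL_mixed : forall a b : int,
    mulRX In_z_over_w (fun i => g Qc ^+ (2 * i) *: to_A (Rser q In_z_over_w i))
      (tens12 (in_z L_plus) 1%:M (in_zinv L_minus)) a b =
    mulXR In_z_over_w (tens21 (in_z L_plus) 1%:M (in_zinv L_minus))
      (fun i => g Qcinv ^+ (2 * i) *: to_A (Rser q In_z_over_w i)) a b
}.

End LOperators.

(** [U], with the family [g], is the unital associative K-algebra presented by
    the generators [Uq_gen] and the relations [Uq_relations]. *)
Definition is_Uq_gl2hat (U : algType K) (g : Uq_gen -> U) : Prop :=
  Uq_relations g /\
  forall (B : algType K) (h : Uq_gen -> B), Uq_relations h ->
    exists phi : {lrmorphism U -> B},
      (forall x, phi (g x) = h x) /\
      forall psi : {lrmorphism U -> B}, (forall x, psi (g x) = h x) -> psi =1 phi.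

Section KOperator.
Variables (A : algType K) (g : Uq_gen -> A).
Variables (kb_p kb_m : K) (eps_p eps_m lambda_inv : A).

(** All series are in 1/z: the n-th term is the coefficient of z^-n. *)
Definition K0 (n : nat) : 'M[A]_2 :=
  match n with
  | 0%N => mx_of_rows 2 2
      [:: [:: eps_p; (kb_p * (q + q^-1) / (q - q^-1))%:A];
          [:: (kb_m * (q + q^-1) / (q - q^-1))%:A; 0]]
  | 1%N => mx_of_rows 2 2 [:: [:: 0; 0]; [:: 0; eps_m]]
  | _ => 0
  end.

(** By [Uq_K_mul], the inverse of k^-_{j,0} is k^+_{j,0}. *)
Definition L_minus0 : 'M[A]_2 := mx_of_rows 2 2
  [:: [:: g (Kp 1 0); 0]; [:: 0; g (Kp 0 0)]].

(** L^-(z lambda) K0(z) L^{-,0}, where [lambda_inv] is the inverse of lambda. *)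
Definition Kop (n : nat) : 'M[A]_2 :=
  (\sum_(i < n.+1) (lambda_inv ^+ i *: L_minus g i) *m K0 (n - i)) *m L_minus0.

End KOperator.

End Uq.

(* Main.v *)
(* Write RLL for the exchange relation of L(z) = L^-(z lambda), l for L^{-,0}, and
   K0 for the constant-coefficient matrix.  The leading coefficient of RLL says that
   the zero modes of the k_j rescale the entries of L by powers of q, which gives
   l_1 R0 L_2(w) = L_2(w) R0 l_1 and the same with 1 and 2 exchanged.  The entries of
   K0 commute with those of L and l, so
     K_1(z) R0 K_2(w) = L_1 L_2 (K0_1(z) R0 K0_2(w)) l_1 l_2,
     K_2(w) R0 K_1(z) = L_2 L_1 (K0_2(w) R0 K0_1(z)) l_1 l_2,
   and l_1 l_2 commutes with R_21.  Hence the claim follows from RLL and from the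
   reflection equation for K0, an identity of matrices over a commutative ring.

   An identity R(z/w) X = Y R'(z/w) of formal series is handled after multiplication
   by z q - w q^-1, which turns R into the pencil w M0 + z M1; as this factor is
   invertible in the relevant ring of series, nothing is lost. *)
Require Import Defs.
From mathcomp Require Import all_boot all_algebra.
From mathcomp Require Import reals complex mxtens ring zify.
Import GRing.Theory.
Local Open Scope ring_scope.

Set Implicit Arguments.
Unset Strict Implicit.

Local Notation mx2 := (mx_of_rows 2 2).
Local Notation mx4 := (mx_of_rows (2 * 2) (2 * 2)).
Local Notation leg1 X := (X *t (1%:M : 'M_2)).
Local Notation leg2 X := ((1%:M : 'M_2) *t X).

(** * Matrices on the tensor square *)

Section ExplicitMatrices.
Variable B : pzRingType.
Implicit Types X Y : 'M[B]_2.

Lemma mx2_eta X : X = mx2 [:: [:: X 0 0; X 0 1]; [:: X 1 0; X 1 1]].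
Proof.
by apply/matrixP=> -[[|[|i]] hi] -[[|[|j]] hj] //; rewrite !mxE /=;
  congr (X _ _); apply: val_inj.
Qed.

Lemma leg1_rows (a b c d : B) : leg1 (mx2 [:: [:: a; b]; [:: c; d]]) =
  mx4 [:: [:: a; 0; b; 0]; [:: 0; a; 0; b]; [:: c; 0; d; 0]; [:: 0; c; 0; d]].
Proof.
by apply/matrixP=> -[[|[|[|[|i]]]] hi] -[[|[|[|[|j]]]] hj] //;
  rewrite !mxE /= ?mulr0 ?mulr1.
Qed.

Lemma leg2_rows (a b c d : B) : leg2 (mx2 [:: [:: a; b]; [:: c; d]]) =
  mx4 [:: [:: a; b; 0; 0]; [:: c; d; 0; 0]; [:: 0; 0; a; b]; [:: 0; 0; c; d]].
Proof.
by apply/matrixP=> -[[|[|[|[|i]]]] hi] -[[|[|[|[|j]]]] hj] //;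
  rewrite !mxE /= ?mul0r ?mul1r.
Qed.

Lemma mul_rows4
    (a00 a01 a02 a03 a10 a11 a12 a13 a20 a21 a22 a23 a30 a31 a32 a33
     b00 b01 b02 b03 b10 b11 b12 b13 b20 b21 b22 b23 b30 b31 b32 b33 : B) :
  mx4 [:: [:: a00; a01; a02; a03]; [:: a10; a11; a12; a13];
          [:: a20; a21; a22; a23]; [:: a30; a31; a32; a33]] *m
  mx4 [:: [:: b00; b01; b02; b03]; [:: b10; b11; b12; b13];
          [:: b20; b21; b22; b23]; [:: b30; b31; b32; b33]] =
  let r a b c d := [:: a * b00 + b * b10 + c * b20 + d * b30;
                       a * b01 + b * b11 + c * b21 + d * b31;
                       a * b02 + b * b12 + c * b22 + d * b32;
                       a * b03 + b * b13 + c * b23 + d * b33] in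
  mx4 [:: r a00 a01 a02 a03; r a10 a11 a12 a13;
          r a20 a21 a22 a23; r a30 a31 a32 a33].
Proof.
by apply/matrixP=> -[[|[|[|[|i]]]] hi] -[[|[|[|[|j]]]] hj] //=;
  rewrite mxE 4?big_ord_recr big_ord0 /= add0r !mxE.
Qed.

Lemma add_rows4
    (a00 a01 a02 a03 a10 a11 a12 a13 a20 a21 a22 a23 a30 a31 a32 a33
     b00 b01 b02 b03 b10 b11 b12 b13 b20 b21 b22 b23 b30 b31 b32 b33 : B) :
  mx4 [:: [:: a00; a01; a02; a03]; [:: a10; a11; a12; a13];
          [:: a20; a21; a22; a23]; [:: a30; a31; a32; a33]] +
  mx4 [:: [:: b00; b01; b02; b03]; [:: b10; b11; b12; b13];
          [:: b20; b21; b22; b23]; [:: b30; b31; b32; b33]] =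
  mx4 [:: [:: a00 + b00; a01 + b01; a02 + b02; a03 + b03];
          [:: a10 + b10; a11 + b11; a12 + b12; a13 + b13];
          [:: a20 + b20; a21 + b21; a22 + b22; a23 + b23];
          [:: a30 + b30; a31 + b31; a32 + b32; a33 + b33]].
Proof.
by apply/matrixP=> -[[|[|[|[|i]]]] hi] -[[|[|[|[|j]]]] hj] //=; rewrite !mxE.
Qed.

Lemma rows4_inj
    (a00 a01 a02 a03 a10 a11 a12 a13 a20 a21 a22 a23 a30 a31 a32 a33
     b00 b01 b02 b03 b10 b11 b12 b13 b20 b21 b22 b23 b30 b31 b32 b33 : B) :
  mx4 [:: [:: a00; a01; a02; a03]; [:: a10; a11; a12; a13];
          [:: a20; a21; a22; a23]; [:: a30; a31; a32; a33]] =
  mx4 [:: [:: b00; b01; b02; b03]; [:: b10; b11; b12; b13];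
          [:: b20; b21; b22; b23]; [:: b30; b31; b32; b33]] ->
  [/\ [/\ a00 = b00, a01 = b01, a02 = b02 & a03 = b03],
      [/\ a10 = b10, a11 = b11, a12 = b12 & a13 = b13],
      [/\ a20 = b20, a21 = b21, a22 = b22 & a23 = b23] &
      [/\ a30 = b30, a31 = b31, a32 = b32 & a33 = b33]].
Proof.
move=> h.
have e i j (hi : (i < 4)%N) (hj : (j < 4)%N) :=
  congr1 (fun M : 'M_(2 * 2) => M (@Ordinal 4 i hi) (@Ordinal 4 j hj)) h.
by split; split;
  [ have := e 0%N 0%N isT isT | have := e 0%N 1%N isT isT
  | have := e 0%N 2%N isT isT | have := e 0%N 3%N isT isT
  | have := e 1%N 0%N isT isT | have := e 1%N 1%N isT isT
  | have := e 1%N 2%N isT isT | have := e 1%N 3%N isT isT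
  | have := e 2%N 0%N isT isT | have := e 2%N 1%N isT isT
  | have := e 2%N 2%N isT isT | have := e 2%N 3%N isT isT
  | have := e 3%N 0%N isT isT | have := e 3%N 1%N isT isT
  | have := e 3%N 2%N isT isT | have := e 3%N 3%N isT isT ]; rewrite !mxE.
Qed.

Lemma map_rows4 (S : pzRingType) (f : B -> S)
    (a00 a01 a02 a03 a10 a11 a12 a13 a20 a21 a22 a23 a30 a31 a32 a33 : B) :
  map_mx f (mx4 [:: [:: a00; a01; a02; a03]; [:: a10; a11; a12; a13];
                    [:: a20; a21; a22; a23]; [:: a30; a31; a32; a33]]) =
  mx4 [:: [:: f a00; f a01; f a02; f a03]; [:: f a10; f a11; f a12; f a13];
          [:: f a20; f a21; f a22; f a23]; [:: f a30; f a31; f a32; f a33]].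
Proof.
by apply/matrixP=> -[[|[|[|[|i]]]] hi] -[[|[|[|[|j]]]] hj] //=; rewrite !mxE.
Qed.

End ExplicitMatrices.

Lemma scalemxAr_comm (B : pzRingType) m n p (c : B) (M : 'M[B]_(m, n)) (X : 'M[B]_(n, p)) :
  (forall i j, GRing.comm c (M i j)) -> M *m (c *: X) = c *: (M *m X).
Proof.
move=> cM; apply/matrixP=> i j; rewrite !mxE mulr_sumr; apply: eq_bigr => k _.
by rewrite !mxE !mulrA cM.
Qed.

Definition simp_ring := (mul0r, mulr0, add0r, addr0, mul1r, mulr1, mulrA).

(* [tensmx_mul] requires commutative coefficients; the lemmas below are the cases
   that hold over any ring. *)
Section Legs.
Variable B : pzRingType.
Implicit Types X Y : 'M[B]_2.

Lemma leg1M X Y : leg1 (X *m Y) = leg1 X *m leg1 Y.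
Proof.
rewrite [X *m Y]mx2_eta [in RHS](mx2_eta X) [in RHS](mx2_eta Y) !leg1_rows mul_rows4.
by rewrite !mxE !big_ord_recl !big_ord0 /= !simp_ring; congr mx_of_rows; do !congr cons;
  congr (_ + X _ _ * Y _ _); apply: val_inj.
Qed.

Lemma leg2M X Y : leg2 (X *m Y) = leg2 X *m leg2 Y.
Proof.
rewrite [X *m Y]mx2_eta [in RHS](mx2_eta X) [in RHS](mx2_eta Y) !leg2_rows mul_rows4.
by rewrite !mxE !big_ord_recl !big_ord0 /= !simp_ring; congr mx_of_rows; do !congr cons;
  congr (_ + X _ _ * Y _ _); apply: val_inj.
Qed.

Lemma leg1D X Y : leg1 (X + Y) = leg1 X + leg1 Y.
Proof. by apply/matrixP=> i j; rewrite !mxE mulrDl. Qed.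

Lemma leg2D X Y : leg2 (X + Y) = leg2 X + leg2 Y.
Proof. by apply/matrixP=> i j; rewrite !mxE mulrDr. Qed.

Lemma leg1Z c X : leg1 (c *: X) = c *: leg1 X.
Proof. by apply/matrixP=> i j; rewrite !mxE mulrA. Qed.

Lemma leg2Z c X : leg2 (c *: X) = c *: leg2 X.
Proof.
by apply/matrixP=> i j; rewrite !mxE; case: eqP; rewrite ?mul0r ?mulr0 ?mul1r.
Qed.

Lemma leg12C X Y : (forall i j k l, GRing.comm (X i j) (Y k l)) ->
  leg1 X *m leg2 Y = leg2 Y *m leg1 X.
Proof.
move=> c; rewrite [X]mx2_eta [Y]mx2_eta leg1_rows leg2_rows !mul_rows4.
lazy beta zeta; rewrite !simp_ring.
by congr mx_of_rows; do !congr cons; exact: c.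
Qed.

Lemma comm_leg1 (c : B) X : (forall i j, GRing.comm c (X i j)) ->
  forall i j, GRing.comm c (leg1 X i j).
Proof.
move=> h i j; rewrite mxE; apply: commrM; first exact: h.
by rewrite mxE; exact: commr_nat.
Qed.

Lemma comm_leg2 (c : B) X : (forall i j, GRing.comm c (X i j)) ->
  forall i j, GRing.comm c (leg2 X i j).
Proof.
move=> h i j; rewrite mxE; apply: commrM; last exact: h.
by rewrite mxE; exact: commr_nat.
Qed.

Lemma leg12Z c d X Y : (forall i j, GRing.comm d (X i j)) ->
  leg1 (c *: X) *m leg2 (d *: Y) = (c * d) *: (leg1 X *m leg2 Y).
Proof.
by move=> h; rewrite leg1Z leg2Z -scalemxAl scalemxAr_comm ?scalerA //; exact: comm_leg1.
Qed.

Lemma leg21Z c d X Y : (forall i j, GRing.comm c (Y i j)) ->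
  leg2 (d *: Y) *m leg1 (c *: X) = (d * c) *: (leg2 Y *m leg1 X).
Proof.
by move=> h; rewrite leg1Z leg2Z -scalemxAl scalemxAr_comm ?scalerA //; exact: comm_leg2.
Qed.

Variables (R : 'M[B]_(2 * 2)) (l : 'M[B]_2).

(** The factor [l] of the first leg moves right past [R] and [Y], then [k] moves past [Y], and
    finally [l] past [h]. In the application [X] and [Y] are coefficients of L, [k] and [h] are
    coefficients of K0, and [l] is the diagonal factor. *)
Lemma dress12 X Y k h :
  leg1 k *m leg2 Y = leg2 Y *m leg1 k ->
  leg1 l *m R *m leg2 Y = leg2 Y *m R *m leg1 l ->
  leg1 l *m leg2 h = leg2 h *m leg1 l ->
  leg1 (X *m k *m l) *m R *m leg2 (Y *m h *m l) =
  leg1 X *m leg2 Y *m (leg1 k *m R *m leg2 h) *m (leg1 l *m leg2 l).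
Proof.
move=> kY lY lh; rewrite !leg1M !leg2M -!mulmxA.
by rewrite (mulmxA (leg1 l) R) (mulmxA (leg1 l *m R)) lY -!mulmxA (mulmxA (leg1 k)) kY
  (mulmxA (leg1 l)) lh !mulmxA.
Qed.

(** As for [dress12], with the legs exchanged. The last hypothesis restores the order
    [leg1 l *m leg2 l], so that both products end in the same factor. *)
Lemma dress21 X Y k h :
  leg1 X *m leg2 h = leg2 h *m leg1 X ->
  leg2 l *m R *m leg1 X = leg1 X *m R *m leg2 l ->
  leg1 k *m leg2 l = leg2 l *m leg1 k ->
  leg1 l *m leg2 l = leg2 l *m leg1 l ->
  leg2 (Y *m h *m l) *m R *m leg1 (X *m k *m l) =
  leg2 Y *m leg1 X *m (leg2 h *m R *m leg1 k) *m (leg1 l *m leg2 l).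
Proof.
move=> Xh lX kl ll; rewrite !leg1M !leg2M -!mulmxA.
by rewrite (mulmxA (leg2 l) R) (mulmxA (leg2 l *m R)) lX -!mulmxA (mulmxA (leg2 h)) -Xh
  (mulmxA (leg2 l)) -kl ll !mulmxA.
Qed.

End Legs.

Lemma map_leg1 (B C : pzRingType) (f : {rmorphism B -> C}) (X : 'M[B]_2) :
  map_mx f (leg1 X) = leg1 (map_mx f X).
Proof. by rewrite map_mxT map_mx1. Qed.

Lemma map_leg2 (B C : pzRingType) (f : {rmorphism B -> C}) (X : 'M[B]_2) :
  map_mx f (leg2 X) = leg2 (map_mx f X).
Proof. by rewrite map_mxT map_mx1. Qed.

Lemma comm_alg (K : fieldType) (A : algType K) (c : K) (x : A) : GRing.comm c%:A x.
Proof. by rewrite /GRing.comm mulr_algl mulr_algr. Qed.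

(** * Clearing the denominator of the R-matrix *)

Section Pencil.
Variable B : pzRingType.
Implicit Types X Y : series2 B.

(** The exponent 0 is allowed. Under this bound the truncation at [|a| + |b|] in [mulRX] and [mulXR]
    drops only zero terms. *)
Definition in_negative_powers X :=
  forall a b : int, (0 < a) || (0 < b) -> X a b = 0.

(* (w M0 + z M1) X(z, w) = Y(z, w) (w N0 + z N1) *)
Definition intertwined (M0 M1 N0 N1 : 'M[B]_(2 * 2)) X Y := forall a b : int,
  M0 *m X a (b - 1) + M1 *m X (a - 1) b = Y a (b - 1) *m N0 + Y (a - 1) b *m N1.

(* [X(z, w)] times the sum of the [C s t / (z^s w^t)] over [s, t <= 1] *)
Definition mul_linear X (C : nat -> nat -> 'M[B]_(2 * 2)) : series2 B := fun a b =>
  X a b *m C 0%N 0%N + X a (b + 1) *m C 0%N 1%N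
  + X (a + 1) b *m C 1%N 0%N + X (a + 1) (b + 1) *m C 1%N 1%N.

(* [intertwined], coefficient by coefficient, for polynomials in 1/z and 1/w of degree
   at most one in each. *)
Definition intertwined_linear (M0 M1 N0 N1 : 'M[B]_(2 * 2))
    (C D : nat -> nat -> 'M[B]_(2 * 2)) :=
  [/\ M0 *m C 0%N 0%N = D 0%N 0%N *m N0, M1 *m C 0%N 0%N = D 0%N 0%N *m N1,
      M0 *m C 1%N 0%N = D 1%N 0%N *m N0 & M1 *m C 0%N 1%N = D 0%N 1%N *m N1] /\
  [/\ M0 *m C 1%N 1%N = D 1%N 1%N *m N0, M1 *m C 1%N 1%N = D 1%N 1%N *m N1 &
      M0 *m C 0%N 1%N + M1 *m C 1%N 0%N = D 0%N 1%N *m N0 + D 1%N 0%N *m N1].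

(** Exchange relations compose: from M X = Y N and N C = D P for the pencils follows M X C = Y N C =
    Y D P. *)
Lemma intertwined_mul (M0 M1 N0 N1 P0 P1 : 'M[B]_(2 * 2)) X Y C D :
  intertwined M0 M1 N0 N1 X Y -> intertwined_linear N0 N1 P0 P1 C D ->
  intertwined M0 M1 P0 P1 (mul_linear X C) (mul_linear Y D).
Proof.
move=> XY [[C00 C00' C10 C01] [C11 C11' CC]] a b; rewrite /mul_linear.
have e (a' b' : int) (c : 'M_(2 * 2)) := congr1 (mulmx^~ c) (XY a' b').
have := (e a b (C 0%N 0%N), e a (b + 1) (C 0%N 1%N), e (a + 1) b (C 1%N 0%N),
         e (a + 1) (b + 1) (C 1%N 1%N)).
rewrite !mulmxDl !mulmxDr !addrK ?subrK !mulmxA => -[[[e00 e01] e10] e11].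
rewrite addrACA [X in X + _]addrACA [X in X + _ + _]addrACA e00 e01 e10 e11.
rewrite -!mulmxA C00 C00' C10 C01 C11 C11' !mulmxA.
(* The hypothesis controls [C 0 1] under [N0] and [C 1 0] under [N1] only through their sum. Both
   terms occur here with the same left factor [Y a b], so one can be eliminated. *)
have -> : Y a b *m N0 *m C 0%N 1%N =
    Y a b *m (D 0%N 1%N *m P0 + D 1%N 0%N *m P1 - N1 *m C 1%N 0%N).
  by rewrite -CC addrK mulmxA.
rewrite mulmxBr mulmxDr !mulmxA.
by rewrite [LHS](AC (2*4*2*2) ((1*3*7*9)*(2*6*4*10)*(5*8))) /= addNr addr0.
Qed.

End Pencil.

(** The entries of the pencils are scalars, which a morphism of K-algebras preserves. *)
Lemma map_intertwined (K : fieldType) (U A : algType K) (phi : {lrmorphism U -> A})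
    (M0 M1 N0 N1 : 'M[K]_(2 * 2)) (X Y : series2 U) :
  intertwined (to_A U M0) (to_A U M1) (to_A U N0) (to_A U N1) X Y ->
  intertwined (to_A A M0) (to_A A M1) (to_A A N0) (to_A A N1)
    (fun a b => map_mx phi (X a b)) (fun a b => map_mx phi (Y a b)).
Proof.
have E (M : 'M[K]_(2 * 2)) : to_A A M = map_mx phi (to_A U M).
  by apply/matrixP => i j; rewrite !mxE !in_algE rmorph_alg.
by move=> h a b; rewrite !E -!map_mxM -!map_mxD h.
Qed.

Section GeometricSeries.
Variables (K : fieldType) (q : K).

(* Coefficients of (N0 + x N1) / (x q - q^-1) with x = z/w, so that
   [Rser q d] is [geom (Rnum0 q) (Rnum1 q) d] by conversion. *)
Definition geom (N0 N1 : 'M[K]_(2 * 2)) (d : expansion) (i : nat) : 'M[K]_(2 * 2) :=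
  match d with
  | In_z_over_w =>
      - q *: (q ^+ (2 * i) *: N0 + (if (0 < i)%N then q ^+ (2 * i.-1) *: N1 else 0))
  | In_w_over_z =>
      q^-1 *: (q ^- (2 * i) *: N1 + (if (0 < i)%N then q ^- (2 * i.-1) *: N0 else 0))
  end.

(** Coefficients of 1 / (z q - w q^-1): that of z^i w^(-i-1) in the expansion in z/w, and that of
    z^(-i-1) w^i in the expansion in w/z. *)
Definition geom_coef (d : expansion) (i : nat) : K :=
  match d with
  | In_z_over_w => - q * q ^+ (2 * i)
  | In_w_over_z => q^-1 * q ^- (2 * i)
  end.

Variable A : algType K.
Implicit Types X Y : series2 A.

(** Multiplying by the expanded quotient amounts to multiplying by the pencil w N0 + z N1 and then
    by the series of 1 / (z q - w q^-1). The linear map [F] stands for multiplication of a series by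
    a matrix on either side. *)
Lemma geom_sum (N0 N1 : 'M[K]_(2 * 2)) d (F : 'M[K]_(2 * 2) -> series2 A) (a b : int) :
  (forall M, in_negative_powers (F M)) ->
  (forall M N a b, F (M + N) a b = F M a b + F N a b) ->
  (forall c M a b, F (c *: M) a b = c%:A *: F M a b) ->
  let n := (`|a| + `|b|).+1 in
  \sum_(i < n) F (geom N0 N1 d i) (a - exp_shift d i) (b + exp_shift d i) =
  \sum_(i < n) (geom_coef d i)%:A *:
    match d with
    | In_z_over_w => F N0 (a - i%:Z) (b + i%:Z + 1 - 1) + F N1 (a - i%:Z - 1) (b + i%:Z + 1)
    | In_w_over_z => F N0 (a + i%:Z + 1) (b - i%:Z - 1) + F N1 (a + i%:Z + 1 - 1) (b - i%:Z)
    end.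
Proof.
move=> Fneg FD FZ n.
have F0 a' b' : F 0 a' b' = 0 by rewrite -(scale0r 0) FZ !scale0r.
have scA (c c' : K) (M : 'M[A]_(2 * 2)) : c%:A *: (c'%:A *: M) = (c * c')%:A *: M.
  by rewrite scalerA -scalerAl mul1r scalerA.
case: d => /=.
- under eq_bigr => i _ do rewrite FZ FD scalerDr FZ scA.
  under [RHS]eq_bigr => i _ do rewrite scalerDr.
  rewrite !big_split /=; congr (_ + _).
    by apply: eq_bigr => i _; rewrite addrK.
  (* The [N1] sums differ by a shift of the index. The first term on the left is [F 0]; the last one
     on the right has the positive exponent [b + |a| + |b| + 1] of w. *)
  rewrite /n big_ord_recl [RHS]big_ord_recr /= F0 scaler0 add0r.
  rewrite [X in _ = _ + _ *: X](Fneg N1 _ _) ?scaler0 ?addr0; last by lia.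
  apply: eq_bigr => i _; rewrite /bump /= add1n FZ scA.
  by congr (_ *: F _ _ _); lia.
- under eq_bigr => i _ do rewrite FZ FD scalerDr FZ scA.
  under [RHS]eq_bigr => i _ do rewrite scalerDr addrC.
  rewrite !big_split /=; congr (_ + _).
    by apply: eq_bigr => i _; congr (_ *: F _ _ _); lia.
  rewrite /n big_ord_recl [RHS]big_ord_recr /= F0 scaler0 add0r.
  rewrite [X in _ = _ + _ *: X](Fneg N0 _ _) ?scaler0 ?addr0; last by lia.
  apply: eq_bigr => i _; rewrite /bump /= add1n FZ scA.
  by congr (_ *: F _ _ _); lia.
Qed.

Lemma mulRX_geom (N0 N1 : 'M[K]_(2 * 2)) d X a b : in_negative_powers X ->
  mulRX d (fun i => to_A A (geom N0 N1 d i)) X a b =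
  \sum_(i < (`|a| + `|b|).+1) (geom_coef d i)%:A *:
    match d with
    | In_z_over_w => to_A A N0 *m X (a - i%:Z) (b + i%:Z + 1 - 1)
                     + to_A A N1 *m X (a - i%:Z - 1) (b + i%:Z + 1)
    | In_w_over_z => to_A A N0 *m X (a + i%:Z + 1) (b - i%:Z - 1)
                     + to_A A N1 *m X (a + i%:Z + 1 - 1) (b - i%:Z)
    end.
Proof.
move=> Xneg; apply: (@geom_sum N0 N1 d (fun M a b => to_A A M *m X a b)).
- by move=> M a' b' h; rewrite Xneg ?mulmx0.
- by move=> M N a' b'; rewrite /to_A map_mxD mulmxDl.
- by move=> c M a' b'; rewrite /to_A map_mxZ -scalemxAl.
Qed.

Lemma mulXR_geom (N0 N1 : 'M[K]_(2 * 2)) d X a b : in_negative_powers X ->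
  mulXR d X (fun i => to_A A (geom N0 N1 d i)) a b =
  \sum_(i < (`|a| + `|b|).+1) (geom_coef d i)%:A *:
    match d with
    | In_z_over_w => X (a - i%:Z) (b + i%:Z + 1 - 1) *m to_A A N0
                     + X (a - i%:Z - 1) (b + i%:Z + 1) *m to_A A N1
    | In_w_over_z => X (a + i%:Z + 1) (b - i%:Z - 1) *m to_A A N0
                     + X (a + i%:Z + 1 - 1) (b - i%:Z) *m to_A A N1
    end.
Proof.
move=> Xneg; apply: (@geom_sum N0 N1 d (fun M a b => X a b *m to_A A M)).
- by move=> M a' b' h; rewrite Xneg ?mul0mx.
- by move=> M N a' b'; rewrite /to_A map_mxD mulmxDr.
- move=> c M a' b'; rewrite /to_A map_mxZ scalemxAr_comm // => i j.
  exact: comm_alg.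
Qed.

(** Division by z q - w q^-1, in either expansion. *)
Lemma geom_of_intertwined (M0 M1 N0 N1 : 'M[K]_(2 * 2)) X Y d a b :
  in_negative_powers X -> in_negative_powers Y ->
  intertwined (to_A A M0) (to_A A M1) (to_A A N0) (to_A A N1) X Y ->
  mulRX d (fun i => to_A A (geom M0 M1 d i)) X a b =
  mulXR d Y (fun i => to_A A (geom N0 N1 d i)) a b.
Proof.
move=> Xn Yn h; rewrite mulRX_geom // mulXR_geom //.
by apply: eq_bigr => i _; case: d => /=; rewrite h.
Qed.

Lemma intertwined_of_geom (M0 M1 N0 N1 : 'M[K]_(2 * 2)) X Y : q != 0 ->
  in_negative_powers X -> in_negative_powers Y ->
  (forall a b, mulRX In_z_over_w (fun i => to_A A (geom M0 M1 In_z_over_w i)) X a b =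
    mulXR In_z_over_w Y (fun i => to_A A (geom N0 N1 In_z_over_w i)) a b) ->
  intertwined (to_A A M0) (to_A A M1) (to_A A N0) (to_A A N1) X Y.
Proof.
move=> q0 Xn Yn h.
pose H a b := to_A A M0 *m X a (b - 1) + to_A A M1 *m X (a - 1) b
              - (Y a (b - 1) *m to_A A N0 + Y (a - 1) b *m to_A A N1).
(* [H a b = 0] for [b >= 2]; then descend in [b], since [H a b] is the only term of the
   hypothesis at [(a, b - 1)] whose second index is [<= b]. *)
suff H0 (n : nat) : forall a b : int, 2 <= b + n%:Z -> H a b = 0.
  by move=> a b; apply/subr0_eq/(H0 (`|b| + 2)%N); lia.
elim: n => [|n IH] a b hb.
  (* For [b >= 2] both exponents [b - 1] and [b] of w are positive, so all four terms vanish. *)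
  by rewrite /H !(Xn, Yn) ?mulmx0 ?mul0mx ?subrr //; lia.
have /eqP := h a (b - 1); rewrite mulRX_geom // mulXR_geom // -subr_eq0 -sumrB.
under eq_bigr => i _ do rewrite -scalerBr -[X in _ *: X]/(H _ _).
rewrite big_ord_recl big1 => [|i _]; last first.
  by rewrite IH ?scaler0 //= /bump; lia.
rewrite /= addr0 subr0 addr0 subrK muln0 expr0 mulr1 => /eqP e.
have := congr1 ( *:%R ((- q)^-1)%:A) e.
by rewrite scaler0 scalerA -scalerAl mul1r scalerA mulVf ?oppr_eq0 // !scale1r.
Qed.

(* [P Rnum0 P] and [P Rnum1 P], the numerator of [R_21]. *)
Definition Rnum0_21 : 'M[K]_(2 * 2) := mx4
  [:: [:: - q^-1; 0; 0; 0]; [:: 0; -1; q - q^-1; 0];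
      [:: 0; 0; -1; 0]; [:: 0; 0; 0; - q^-1]].
Definition Rnum1_21 : 'M[K]_(2 * 2) := mx4
  [:: [:: q; 0; 0; 0]; [:: 0; 1; 0; 0];
      [:: 0; q - q^-1; 1; 0]; [:: 0; 0; 0; q]].

(** Conjugation by P is linear, so it acts on the numerator alone and keeps the geometric series. *)
Lemma Pmx_conj_geom (M0 M1 : 'M[K]_(2 * 2)) d i :
  Pmx q *m geom M0 M1 d i *m Pmx q =
  geom (Pmx q *m M0 *m Pmx q) (Pmx q *m M1 *m Pmx q) d i.
Proof.
have PD (M N : 'M[K]_(2 * 2)) :
    Pmx q *m (M + N) *m Pmx q = Pmx q *m M *m Pmx q + Pmx q *m N *m Pmx q.
  by rewrite mulmxDr mulmxDl.
have PZ c (M : 'M[K]_(2 * 2)) : Pmx q *m (c *: M) *m Pmx q = c *: (Pmx q *m M *m Pmx q).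
  by rewrite -scalemxAr -scalemxAl.
by case: d => /=; rewrite PZ PD PZ; case: ifP => _; rewrite ?PZ ?mulmx0 ?mul0mx.
Qed.

Lemma Pmx_rows : q - q^-1 != 0 ->
  Pmx q = mx4 [:: [:: 1; 0; 0; 0]; [:: 0; 0; 1; 0]; [:: 0; 1; 0; 0]; [:: 0; 0; 0; 1]].
Proof. by move=> qq; rewrite /Pmx /Rt subrr mul0r !mul1r divff. Qed.

Lemma Rser21_geom d i : q - q^-1 != 0 -> Rser21 q d i = geom Rnum0_21 Rnum1_21 d i.
Proof.
move=> qq; have -> : Rnum0_21 = Pmx q *m Rnum0 q *m Pmx q.
  rewrite Pmx_rows // !mul_rows4; lazy beta zeta.
  by congr mx_of_rows; do !congr cons; rewrite !simp_ring.
have -> : Rnum1_21 = Pmx q *m Rnum1 q *m Pmx q.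
  rewrite Pmx_rows // !mul_rows4; lazy beta zeta.
  by congr mx_of_rows; do !congr cons; rewrite !simp_ring.
by rewrite -Pmx_conj_geom; case: d.
Qed.

End GeometricSeries.

(** * The reflection equation for the constant matrix *)

(* The n-th term is the coefficient of z^-n in [[e, x], [y, m/z]]. *)
Definition K0_mx (B : pzRingType) (e m x y : B) (n : nat) : 'M[B]_2 :=
  match n with
  | 0%N => mx2 [:: [:: e; x]; [:: y; 0]]
  | 1%N => mx2 [:: [:: 0; 0]; [:: 0; m]]
  | _ => 0
  end.

(** Entry by entry these are polynomial identities in [e], [m], [x], [y] and the images of q and
    q^-1, modulo the relation that the last two have product 1. *)
Lemma K0_reflection_com (K : fieldType) (q : K) (B : comNzRingType)
    (f : {rmorphism K -> B}) (e m x y : B) :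
  q != 0 ->
  let k := K0_mx e m x y in
  intertwined_linear (map_mx f (Rnum0 q)) (map_mx f (Rnum1 q))
    (map_mx f (Rnum0_21 q)) (map_mx f (Rnum1_21 q))
    (fun s t => leg1 (k s) *m map_mx f (R0 q) *m leg2 (k t))
    (fun s t => leg2 (k t) *m map_mx f (R0 q) *m leg1 (k s)).
Proof.
move=> q0 k.
have qK : f q * f (q^-1) = 1 by rewrite -rmorphM divff ?rmorph1.
rewrite /intertwined_linear /k /K0_mx !map_rows4 !leg1_rows !leg2_rows.
rewrite !rmorph0 ?(rmorph1, rmorphN, rmorphB).
move: (f q) (f q^-1) qK => p pi qK.
do !split.
all: rewrite !mul_rows4; lazy beta zeta; rewrite ?add_rows4.
all: congr mx_of_rows; do !congr cons.
all: ring: qK.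
Qed.

Section ConstantReflection.
Variables (K : fieldType) (A : algType K).

(** This makes the evaluation of K[X][Y] at a commuting pair a ring morphism. *)
Lemma commr_horner_alg (u v : A) : GRing.comm u v -> commr_rmorph (horner_alg u) v.
Proof.
move=> uv p; apply: commr_horner; first exact/commr_sym.
by move=> i; rewrite coef_map; exact: comm_alg.
Qed.

(* As [e] and [m] commute, the identity is the image of the one over K[X][Y]. *)
Lemma K0_reflection (q : K) (e m : A) (x y : K) : q != 0 -> GRing.comm e m ->
  let k := K0_mx e m x%:A y%:A in
  intertwined_linear (to_A A (Rnum0 q)) (to_A A (Rnum1 q))
    (to_A A (Rnum0_21 q)) (to_A A (Rnum1_21 q))
    (fun s t => leg1 (k s) *m to_A A (R0 q) *m leg2 (k t))
    (fun s t => leg2 (k t) *m to_A A (R0 q) *m leg1 (k s)).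
Proof.
move=> q0 em k.
pose f : {rmorphism K -> {poly {poly K}}} := polyC \o polyC.
pose psi : {rmorphism {poly {poly K}} -> A} := horner_morph (commr_horner_alg em).
have psif c : psi (f c) = c%:A by rewrite [LHS]horner_morphC; exact: horner_algC.
have psie : psi 'X%:P = e by rewrite [LHS]horner_morphC; exact: horner_algX.
have psim : psi 'X = m by exact: horner_morphX.
have kE s : k s = map_mx psi (K0_mx 'X%:P 'X (f x) (f y) s).
  case: s => [|[|s]]; rewrite ?map_mx0 //;
    apply/matrixP => -[[|[|i]] hi] -[[|[|j]] hj] //;
    by rewrite !mxE; cbn [nth nat_of_ord]; rewrite ?rmorph0 ?psif ?psie ?psim.
have AE M : to_A A M = map_mx psi (map_mx f M).
  by apply/matrixP=> i j; rewrite !mxE; exact: esym (psif _).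
have [[h1 h2 h3 h4] [h5 h6 h7]] := K0_reflection_com f 'X%:P 'X (f x) (f y) q0.
rewrite /intertwined_linear !AE !kE -!map_leg1 -!map_leg2 -!map_mxM -!map_mxD.
by rewrite h1 h2 h3 h4 h5 h6 h7.
Qed.

End ConstantReflection.

(** * Zero modes *)

Section ZeroModes.
Variables (K : fieldType) (q : K) (A : algType K).

(** Multiply by [ki] on both sides. With [c = 1], whatever commutes with [k] commutes with its
    inverse. *)
Lemma comm_inv_scale (k ki x : A) (c : K) : ki * k = 1 -> k * ki = 1 ->
  k * x = c *: (x * k) -> x * ki = c *: (ki * x).
Proof.
move=> kK kV e; rewrite -[x in LHS]mul1r -kK -(mulrA ki) e.
by rewrite -scalerAr -scalerAl -!mulrA kV mulr1.
Qed.

(** For M = [[a, b], [c, d]], the diagonal blocks of the matrix relation say that [k1] and [k2]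
    commute with [a] and [d], and that k1 b = q^-1 b k1, k1 c = q c k1, k2 b = q b k2, k2 c = q^-1 c
    k2. These powers of q are the ones that [R0] compensates when diag(k2^-1, k1^-1) is moved past
    [M]. *)
Lemma swap_diag (k1 k2 k1i k2i : A) (L0 M : 'M[A]_2) : q != 0 ->
  k1i * k1 = 1 -> k1 * k1i = 1 -> k2i * k2 = 1 -> k2 * k2i = 1 ->
  L0 0 0 = k1 -> L0 1 0 = 0 -> L0 1 1 = k2 ->
  to_A A (Rnum1 q) *m (leg1 L0 *m leg2 M) = leg2 M *m leg1 L0 *m to_A A (Rnum1 q) ->
  let l := mx2 [:: [:: k2i; 0]; [:: 0; k1i]] in
  [/\ leg1 l *m to_A A (R0 q) *m leg2 M = leg2 M *m to_A A (R0 q) *m leg1 l,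
      leg2 l *m to_A A (R0 q) *m leg1 M = leg1 M *m to_A A (R0 q) *m leg2 l &
      GRing.comm k1 (M 1 1)].
Proof.
move=> q0 k1K k1V k2K k2V L00 L10 L11.
rewrite (mx2_eta L0) L00 L10 L11 (mx2_eta M) /to_A !map_rows4 !leg1_rows !leg2_rows.
move: (L0 0 1) (M 0 0) (M 0 1) (M 1 0) (M 1 1) => u a b c d.
rewrite !rmorph0 !rmorph1 !in_algE !mul_rows4; lazy beta zeta.
case/rows4_inj=> -[e00 e01 _ _] [e10 e11 _ _] [_ _ e22 e23] [_ _ e32 e33].
pose simpZ := (mulr_algl, mulr_algr, mul0r, mulr0, add0r, addr0, mul1r, mulr1).
rewrite !simpZ ?scaler0 ?addr0 ?add0r in e00 e01 e10 e11 e22 e23 e32 e33.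
have qI (x y : A) : q *: x = q *: y -> x = y by apply: scalerI.
have inv x y : q *: x = y -> x = q^-1 *: y.
  by move=> <-; rewrite scalerA mulVf // scale1r.
have k1a : k1 * a = 1 *: (a * k1) by rewrite scale1r; exact: qI.
have k1b : k1 * b = q^-1 *: (b * k1) by exact: inv.
have k1d : k1 * d = 1 *: (d * k1) by rewrite scale1r.
have k2a : k2 * a = 1 *: (a * k2) by rewrite scale1r.
have k2c : k2 * c = q^-1 *: (c * k2) by exact: inv.
have k2d : k2 * d = 1 *: (d * k2) by rewrite scale1r; exact: qI.
have := (comm_inv_scale k1K k1V k1a, comm_inv_scale k1K k1V k1b,
         comm_inv_scale k1K k1V e10, comm_inv_scale k1K k1V k1d,
         comm_inv_scale k2K k2V k2a, comm_inv_scale k2K k2V e23,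
         comm_inv_scale k2K k2V k2c, comm_inv_scale k2K k2V k2d).
rewrite !scale1r => ec.
split; last by rewrite /GRing.comm !mxE /= e11.
all: congr mx_of_rows; do !congr cons.
all: rewrite !simpZ ?simpZ.
all: by rewrite -?scalerAl -?scalerAr ?ec ?scalerA ?mulVf ?mulfV ?scale1r
  ?mul0r ?scaler0 ?addr0 ?add0r.
Qed.

End ZeroModes.

(** * The L-operator *)

Section LMinus.
Variables (K : fieldType) (q : K).

Lemma rmorph_cauchy (B C : pzRingType) (f : {rmorphism B -> C}) (u v : nat -> B) n :
  f (cauchy u v n) = cauchy (f \o u) (f \o v) n.
Proof. by rewrite rmorph_sum; apply: eq_bigr => i _; rewrite rmorphM. Qed.

Lemma eq_cauchy (B : pzRingType) (u u' v v' : nat -> B) :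
  u =1 u' -> v =1 v' -> cauchy u v =1 cauchy u' v'.
Proof. by move=> uu vv n; apply: eq_bigr => i _; rewrite uu vv. Qed.

Lemma map_L_minus (U A : algType K) (phi : {lrmorphism U -> A}) (g : Uq_gen -> U) n :
  map_mx phi (L_minus q g n) = L_minus q (phi \o g) n.
Proof.
have ee : phi \o e_minus q g =1 e_minus q (phi \o g).
  move=> k; rewrite /= /e_minus; case: eqP => _; first by rewrite rmorph0.
  by rewrite linearZ /= rmorphM rmorphXn.
have ff : phi \o f_minus q g =1 f_minus q (phi \o g).
  by move=> k; rewrite /= /f_minus linearZ /= rmorphM rmorphXn.
apply/matrixP => -[[|[|i]] hi] -[[|[|j]] hj] //; rewrite !mxE; cbn [nth nat_of_ord].
- by [].
- by apply: etrans (rmorph_cauchy _ _ _ _) _; apply: eq_cauchy.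
- by apply: etrans (rmorph_cauchy _ _ _ _) _; apply: eq_cauchy.
- rewrite rmorphD; congr (_ + _); apply: etrans (rmorph_cauchy _ _ _ _) _.
  apply: eq_cauchy => // k.
  by apply: etrans (rmorph_cauchy _ _ _ _) _; apply: eq_cauchy.
Qed.

Variables (A : algType K) (g : Uq_gen -> A).

Lemma L_minus_00 n : L_minus q g n 0 0 = g (Km 0 n).
Proof. by rewrite !mxE. Qed.

(** The series e^- starts at z^-1, so the leading coefficient of L^- is upper triangular. *)
Lemma L_minus_zero_10 : L_minus q g 0 1 0 = 0.
Proof. by rewrite !mxE /= /cauchy big_ord_recl big_ord0 /e_minus /= mul0r addr0. Qed.

Lemma L_minus_zero_11 : L_minus q g 0 1 1 = g (Km 1 0).
Proof.
by rewrite !mxE /= /cauchy !big_ord_recl !big_ord0 /e_minus /= !(mul0r, addr0).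
Qed.

End LMinus.

Section InverseSeries.

Lemma in_zinvN (V : nmodType) (f : nat -> V) (n : nat) : in_zinv f (- n%:Z) = f n.
Proof. by rewrite /in_zinv opprK. Qed.

Lemma in_zinv_gt0 (V : nmodType) (f : nat -> V) (a : int) : 0 < a -> in_zinv f a = 0.
Proof. by case: a => [[|n]|n]. Qed.

Variables (B : pzRingType) (f h : nat -> 'M[B]_2) (M : 'M[B]_(2 * 2)).

Lemma in_negative_powers12 : in_negative_powers (tens12 (in_zinv f) M (in_zinv h)).
Proof.
by move=> a b; rewrite /tens12 => /orP[] h0;
  rewrite (in_zinv_gt0 _ h0) ?tens0mx ?tensmx0 ?mul0mx ?mulmx0.
Qed.

Lemma in_negative_powers21 : in_negative_powers (tens21 (in_zinv f) M (in_zinv h)).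
Proof.
by move=> a b; rewrite /tens21 => /orP[] h0;
  rewrite (in_zinv_gt0 _ h0) ?tens0mx ?tensmx0 ?mul0mx ?mulmx0.
Qed.

End InverseSeries.

(** * The K-operator *)

Section KOperator.
Variables (K : fieldType) (q : K) (A : algType K) (g : Uq_gen -> A).
Variables (kb_p kb_m : K) (eps_p eps_m li : A).
Hypothesis q0 : q != 0.
Local Notation L := (L_minus q g).
Local Notation Lz := (in_zinv L).
Hypothesis Kinv : forall j,
  g (Kp j 0) * g (Km j 0) = 1 /\ g (Km j 0) * g (Kp j 0) = 1.
Hypothesis RLL : intertwined (to_A A (Rnum0 q)) (to_A A (Rnum1 q))
  (to_A A (Rnum0 q)) (to_A A (Rnum1 q)) (tens12 Lz 1%:M Lz) (tens21 Lz 1%:M Lz).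
Hypotheses (li_L : forall n i j, GRing.comm li (L n i j))
  (li_K : forall j, GRing.comm li (g (Kp j 0)))
  (ep_L : forall n i j, GRing.comm eps_p (L n i j))
  (ep_K : forall j, GRing.comm eps_p (g (Kp j 0)))
  (em_L : forall n i j, GRing.comm eps_m (L n i j))
  (em_K : forall j, GRing.comm eps_m (g (Kp j 0)))
  (ep_em : GRing.comm eps_p eps_m)
  (ep_li : GRing.comm eps_p li) (em_li : GRing.comm eps_m li).

Let l := L_minus0 g.
Let LL := in_zinv (fun n => li ^+ n *: L n : 'M[A]_2).
Let kp := kb_p * (q + q^-1) / (q - q^-1).
Let km := kb_m * (q + q^-1) / (q - q^-1).
Let k := K0_mx eps_p eps_m kp%:A km%:A.
Let R := to_A A (R0 q).
Local Notation Kt := (in_zinv (Kop q g kb_p kb_m eps_p eps_m li)).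

Lemma comm_Lz x : (forall n i j, GRing.comm x (L n i j)) ->
  forall a i j, GRing.comm x (Lz a i j).
Proof.
move=> h a i j; have [a0|] := boolP (0 < a).
  by rewrite in_zinv_gt0 // mxE; exact: commr0.
by case: a => [[|n]|n] // _; apply: h.
Qed.

Lemma LLE a : LL a = li ^+ `|a| *: Lz a.
Proof.
have [a0|] := boolP (0 < a); first by rewrite /LL !in_zinv_gt0 // scaler0.
by case: a => [[|n]|n].
Qed.

Lemma li_Lz n a i j : GRing.comm (li ^+ n) (Lz a i j).
Proof. by apply: commr_sym; apply: commrX; apply: commr_sym; exact: comm_Lz. Qed.

Lemma li_to_A (M : 'M[K]_(2 * 2)) n i j : GRing.comm (li ^+ n) (to_A A M i j).
Proof. by rewrite mxE in_algE; apply/commr_sym/comm_alg. Qed.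

(* The RLL relation is homogeneous in (z, w). *)
Lemma RLL_scaled : intertwined (to_A A (Rnum0 q)) (to_A A (Rnum1 q))
  (to_A A (Rnum0 q)) (to_A A (Rnum1 q)) (tens12 LL 1%:M LL) (tens21 LL 1%:M LL).
Proof.
have neg1 : in_negative_powers (tens12 Lz 1%:M Lz) by exact: in_negative_powers12.
have neg2 : in_negative_powers (tens21 Lz 1%:M Lz) by exact: in_negative_powers21.
(* For nonpositive exponents [|a| + |b| = |a + b|], so the power of [li] depends on the total degree
   only, and this is the same in all four terms of the exchange relation. *)
have e12 a b : tens12 LL 1%:M LL a b = li ^+ `|a + b| *: tens12 Lz 1%:M Lz a b.
  have [ab|ab] := boolP ((0 < a) || (0 < b)).
    by rewrite neg1 // scaler0; exact: in_negative_powers12.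
  rewrite /tens12 !mulmx1 !LLE leg12Z; last exact: li_Lz.
  by rewrite -exprD; congr (_ ^+ _ *: _); lia.
have e21 a b : tens21 LL 1%:M LL a b = li ^+ `|a + b| *: tens21 Lz 1%:M Lz a b.
  have [ab|ab] := boolP ((0 < a) || (0 < b)).
    by rewrite neg2 // scaler0; exact: in_negative_powers21.
  rewrite /tens21 !mulmx1 !LLE leg21Z; last exact: li_Lz.
  by rewrite -exprD; congr (_ ^+ _ *: _); lia.
move=> a b; rewrite !e12 !e21 !scalemxAr_comm; try exact: li_to_A.
have -> : a - 1 + b = a + (b - 1) by lia.
by rewrite -!scalemxAl -!scalerDr RLL.
Qed.

Lemma swap_l a :
  [/\ leg1 l *m R *m leg2 (LL a) = leg2 (LL a) *m R *m leg1 l,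
      leg2 l *m R *m leg1 (LL a) = leg1 (LL a) *m R *m leg2 l &
      GRing.comm (g (Kp 0 0)) (g (Kp 1 0))].
Proof.
have [[K00 K00'] [K10 K10']] := (Kinv 0, Kinv 1).
(* The coefficient of z^1: L has no term in z, so only the [Rnum1] part of the pencil survives. *)
have h b : to_A A (Rnum1 q) *m (leg1 (L 0%N) *m leg2 (Lz b)) =
    leg2 (Lz b) *m leg1 (L 0%N) *m to_A A (Rnum1 q).
  have := RLL 1 b; rewrite /tens12 /tens21 !mulmx1 (in_zinv_gt0 L (a := 1)) //.
  by rewrite tens0mx mul0mx !mulmx0 !mul0mx !add0r.
have sw b := swap_diag q0 K00 K00' K10 K10' (L_minus_00 q g 0)
  (L_minus_zero_10 q g) (L_minus_zero_11 q g) (h b).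
have cl n i j : GRing.comm (li ^+ n) (l i j).
  apply/commr_sym/commrX/commr_sym.
  by case: i => -[|[|i]] hi //; case: j => -[|[|j]] hj //; rewrite mxE /=;
    first [exact: li_K | exact: commr0].
have [s1 s2 _] := sw a; split.
- rewrite LLE leg2Z -mulmxA (scalemxAr_comm _ (li_to_A _ _)) scalemxAr_comm;
    last exact: comm_leg1.
  by rewrite mulmxA s1 -!scalemxAl.
- rewrite LLE leg1Z -mulmxA (scalemxAr_comm _ (li_to_A _ _)) scalemxAr_comm;
    last exact: comm_leg2.
  by rewrite mulmxA s2 -!scalemxAl.
(* Taking the leading coefficient itself for [M] shows that the zero modes of k_1^- and k_2^-
   commute; two passages to inverses follow. *)
- have [_ _] := sw 0; rewrite [Lz 0]/(L 0%N) L_minus_zero_11 => c.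
  have c1 : g (Km 0 0) * g (Km 1 0) = 1 *: (g (Km 1 0) * g (Km 0 0)).
    by rewrite scale1r.
  have := comm_inv_scale K00 K00' c1; rewrite scale1r => c2.
  have c3 : g (Km 1 0) * g (Kp 0 0) = 1 *: (g (Kp 0 0) * g (Km 1 0)).
    by rewrite scale1r.
  by have := comm_inv_scale K10 K10' c3; rewrite scale1r.
Qed.

Lemma comm_k x : GRing.comm eps_p x -> GRing.comm eps_m x ->
  forall s i j, GRing.comm (k s i j) x.
Proof.
move=> cp cm [|[|s]] i j; last by rewrite mxE; exact/commr_sym/commr0.
all: by case: i => -[|[|i]] hi //; case: j => -[|[|j]] hj //; rewrite mxE /=;
  first [exact: cp | exact: cm | exact: comm_alg | exact/commr_sym/commr0].
Qed.

Lemma k_LL s i j a i' j' : GRing.comm (k s i j) (LL a i' j').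
Proof.
rewrite LLE mxE.
by apply: comm_k; (apply: commrM; [exact: commrX | exact: comm_Lz]).
Qed.

Lemma k_l s i j i' j' : GRing.comm (k s i j) (l i' j').
Proof.
by apply: comm_k; case: i' => -[|[|i']] hi //; case: j' => -[|[|j']] hj //; rewrite mxE /=;
  first [exact: ep_K | exact: em_K | exact: commr0].
Qed.

Lemma l_l i j i' j' : GRing.comm (l i j) (l i' j').
Proof.
have [_ _ c] := swap_l 0.
by case: i => -[|[|i]] hi //; case: j => -[|[|j]] hj //;
  case: i' => -[|[|i']] hi' //; case: j' => -[|[|j']] hj' //; rewrite !mxE /=;
  first [exact: commr0 | exact/commr_sym/commr0 | exact: commr_refl
        | exact: c | exact/commr_sym/c].
Qed.

Lemma Kop_coef a : Kt a = LL a *m k 0%N *m l + LL (a + 1) *m k 1%N *m l.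
Proof.
rewrite -mulmxDl; have [a0|] := boolP (0 < a).
  have a1 : 0 < a + 1 by lia.
  rewrite /LL (in_zinv_gt0 _ a0) (in_zinv_gt0 _ a1).
  by rewrite (in_zinv_gt0 _ a0) !mul0mx addr0 mul0mx.
case: a => [[|n]|n] // _; rewrite /in_zinv /= /Kop -/l; congr (_ *m _).
  by rewrite big_ord_recr big_ord0 /= add0r [LL 1]in_zinv_gt0 // mul0mx addr0.
rewrite !big_ord_recr big1 /=; last first.
  (* All summands but the last two involve a coefficient of K0 of index at least 2, which is
     zero. *)
  move=> i _; have -> : (n.+1 - i = (n.+1 - i).-2.+2)%N by have := ltn_ord i; lia.
  by rewrite mulmx0.
rewrite add0r subnn subSnn addrC; congr (_ + _ *m _).
have -> : (Negz n + 1)%R = - n%:Z by lia.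
by rewrite /LL in_zinvN.
Qed.

(** Each coefficient of K has two terms; the four products match those of [mul_linear] after
    rearrangement by [dress12]. *)
Lemma Kop_tens12 a b :
  tens12 Kt R Kt a b =
  mul_linear (tens12 LL 1%:M LL) (fun s t => leg1 (k s) *m R *m leg2 (k t)) a b
  *m (leg1 l *m leg2 l).
Proof.
have k_LL12 s c : leg1 (k s) *m leg2 (LL c) = leg2 (LL c) *m leg1 (k s).
  by apply: leg12C => *; exact: k_LL.
have l_k12 s : leg1 l *m leg2 (k s) = leg2 (k s) *m leg1 l.
  by apply: leg12C => *; apply: commr_sym; exact: k_l.
rewrite /mul_linear !mulmxDl /tens12 !mulmx1 !Kop_coef leg1D leg2D.
rewrite mulmxDl mulmxDl !mulmxDr !addrA !dress12 //.
all: by [case: (swap_l b) | case: (swap_l (b + 1))].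
Qed.

Lemma Kop_tens21 a b :
  tens21 Kt R Kt a b =
  mul_linear (tens21 LL 1%:M LL) (fun s t => leg2 (k t) *m R *m leg1 (k s)) a b
  *m (leg1 l *m leg2 l).
Proof.
have LL_k12 s c : leg1 (LL c) *m leg2 (k s) = leg2 (k s) *m leg1 (LL c).
  by apply: leg12C => *; apply: commr_sym; exact: k_LL.
have k_l12 s : leg1 (k s) *m leg2 l = leg2 l *m leg1 (k s).
  by apply: leg12C => *; exact: k_l.
have l_l12 := leg12C l_l.
rewrite /mul_linear !mulmxDl /tens21 !mulmx1 !Kop_coef leg1D leg2D.
(* With the second leg on the left the exponent of w varies slowest, hence the swap of the two
   middle terms. *)
rewrite mulmxDl mulmxDl !mulmxDr !addrA [in LHS](addrAC (_ *m _)) !dress21 //.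
all: by [case: (swap_l a) | case: (swap_l (a + 1))].
Qed.

(** The product l_1 l_2 is diagonal with equal middle entries, as the two zero modes commute, and
    R_21 mixes only the two middle basis vectors. *)
Lemma Rnum21_l (M : 'M[K]_(2 * 2)) : M = Rnum0_21 q \/ M = Rnum1_21 q ->
  to_A A M *m (leg1 l *m leg2 l) = leg1 l *m leg2 l *m to_A A M.
Proof.
have [_ _ c] := swap_l 0.
rewrite /l /L_minus0 leg1_rows leg2_rows !mul_rows4; lazy beta zeta => -[] ->.
all: rewrite /to_A !map_rows4 !rmorph0 !in_algE !mul_rows4; lazy beta zeta.
all: congr mx_of_rows; do !congr cons.
all: by rewrite !(mulr_algl, mulr_algr, mul0r, mulr0, add0r, addr0, scaler0) ?c.
Qed.

Lemma Kop_reflection d a b : q - q^-1 != 0 ->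
  mulRX d (fun i => to_A A (Rser q d i)) (tens12 Kt R Kt) a b =
  mulXR d (tens21 Kt R Kt) (fun i => to_A A (Rser21 q d i)) a b.
Proof.
move=> qq.
have -> : mulXR d (tens21 Kt R Kt) (fun i => to_A A (Rser21 q d i)) a b =
    mulXR d (tens21 Kt R Kt) (fun i => to_A A (geom q (Rnum0_21 q) (Rnum1_21 q) d i)) a b.
  by apply: eq_bigr => i _; rewrite Rser21_geom.
apply: geom_of_intertwined; [exact: in_negative_powers12 | exact: in_negative_powers21 |].
move=> {}a {}b; rewrite !Kop_tens12 !Kop_tens21 !mulmxA -!(mulmxA _ (leg1 l)).
(* Once moved past R_21, the factor l_1 l_2 stands at the right end of every term and is removed. *)
rewrite -!(mulmxA _ (leg1 l *m leg2 l)) -!Rnum21_l; try by [left | right].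
rewrite !(mulmxA _ _ (leg1 l *m leg2 l)) -!mulmxDl; congr (_ *m _).
(* The pencil of R passes L_1 L_2 unchanged and becomes that of R_21 on passing the K0 factor. *)
exact: (intertwined_mul RLL_scaled (K0_reflection _ _ q0 ep_em)).
Qed.

End KOperator.

(** * Specialization to C(q) *)

Lemma qvar_neq0 (R : realType) : qvar R != 0.
Proof. by rewrite tofrac_eq0 polyX_eq0. Qed.

(** Otherwise X^2 = 1 as polynomials, against the degrees. *)
Lemma qvar_subV_neq0 (R : realType) : qvar R - (qvar R)^-1 != 0.
Proof.
rewrite subr_eq0; apply/eqP => /(congr1 ( *%R (qvar R))) /eqP.
rewrite divff ?qvar_neq0 // -rmorphM -tofrac1 tofrac_eq.
move=> /eqP /(congr1 (size \o polyseq)) /=.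
by rewrite -expr2 size_polyXn size_poly1.
Qed.

Unset Implicit Arguments.
Set Strict Implicit.

Theorem lemma3p6 (R : realType)
    (U : algType (Cq R)) (g : Uq_gen -> U) (hU : is_Uq_gl2hat (qvar R) g)
    (A : algType (Cq R)) (phi : {lrmorphism U -> A})
    (kb_p kb_m : Cq R) (eps_p eps_m : A)
    (eps_pU : forall u : U, GRing.comm eps_p (phi u))
    (eps_mU : forall u : U, GRing.comm eps_m (phi u))
    (eps_pm : GRing.comm eps_p eps_m)
    (lambda lambda_inv : A)
    (lambdaV : lambda * lambda_inv = 1 /\ lambda_inv * lambda = 1)
    (lambdaU : forall u : U, GRing.comm lambda (phi u))
    (lambda_eps_p : GRing.comm lambda eps_p)
    (lambda_eps_m : GRing.comm lambda eps_m) :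
  let Kt := in_zinv (Kop (qvar R) (phi \o g) kb_p kb_m eps_p eps_m lambda_inv) in
  forall (d : expansion) (a b : int),
    mulRX d (fun i => to_A A (Rser (qvar R) d i))
      (tens12 Kt (to_A A (R0 (qvar R))) Kt) a b =
    mulXR d (tens21 Kt (to_A A (R0 (qvar R))) Kt)
      (fun i => to_A A (Rser21 (qvar R) d i)) a b.
Proof.
move=> Kt d a b; case: hU => -[_ _ KK _ RLL _] _.
have [lV Vl] := lambdaV.
have inv_comm x : GRing.comm lambda x -> GRing.comm lambda_inv x.
  move=> e; have e1 : lambda * x = 1 *: (x * lambda) by rewrite scale1r.
  by apply: commr_sym; have := comm_inv_scale Vl lV e1; rewrite scale1r.
have LE n i j : L_minus (qvar R) (phi \o g) n i j = phi (L_minus (qvar R) g n i j).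
  by rewrite -map_L_minus mxE.
have zE c : in_zinv (L_minus (qvar R) (phi \o g)) c = map_mx phi (in_zinv (L_minus (qvar R) g) c).
  rewrite /in_zinv /in_z; case: (- c) => n; last by rewrite map_mx0.
  by rewrite map_L_minus.
(* The denominator is cleared in [U], starting from the expansion in z/w. The resulting relation no
   longer refers to an expansion; it is carried to [A] by [phi] and serves for both values of
   [d]. *)
have RLLU := intertwined_of_geom (qvar_neq0 R) (in_negative_powers12 _ _ _)
  (in_negative_powers21 _ _ _) (RLL In_z_over_w).
apply: Kop_reflection; rewrite ?qvar_neq0 ?qvar_subV_neq0 //.
- by move=> j; have [e1 e2] := KK j; rewrite /= -!rmorphM e1 e2 rmorph1.
- move=> x y; have := map_intertwined phi RLLU x y.
  by rewrite /tens12 /tens21 !map_mxM !map_leg1 !map_leg2 !map_mx1 -!zE.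
- by move=> n i j; rewrite LE; apply: inv_comm.
- by move=> j; apply: inv_comm; exact: lambdaU.
- by move=> n i j; rewrite LE.
- by move=> j; exact: eps_pU.
- by move=> n i j; rewrite LE.
- by move=> j; exact: eps_mU.
- by apply/commr_sym/inv_comm.
- by apply/commr_sym/inv_comm.
Qed.
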